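(* Let $R$ be a commutative ring with $1\neq 0$ and let $|R|,\lambda<\kappa(\omega)$. A free $R$-module $F$ of rank $\lambda$ can be made into a free $R_\omega$-module $\mathbf{F}=(F,F_i : i\in W)$ such that $\mathbf{End}_R\,\mathbf{F}=R$ holds in any generic extension of the given universe.
   Context: $\lambda$ is a cardinal, and $\kappa(\omega)$ denotes the first $\omega$-Erdős cardinal: the smallest cardinal $\kappa$ with $\kappa\to(\omega)^{<\omega}$, i.e. for every function $f$ from the finite subsets of $\kappa$ to $2$ there exist an infinite subset $X\subset\kappa$ and a function $g:\omega\to 2$ such that $f(Y)=g(|Y|)$ for all finite subsets $Y$ of $X$. (Such a cardinal may not exist in every universe.) $W$ is the fixed countable, well-ordered index set $W=\langle 0,1\rangle^\wedge L_1{}^\wedge L_2{}^\wedge L_3$ (concatenation), where $L_1,L_2,L_3$ are copies of $\omega\times\omega$. An $R_\omega$-module $\mathbf{X}=(X,X_i: i\in W)$ is an $R$-module $X$ with a family of (distinguished) submodules $X_i$ $(i\in W)$. It is a free $R_\omega$-module if $X$, $X_i$ and $X/X_i$ are free $R$-modules for all $i\in W$. For $R_\omega$-modules $\mathbf{X},\mathbf{Y}$, $\mathbf{Hom}_R(\mathbf{X},\mathbf{Y})$ is the set of all $\varphi\in\operatorname{Hom}_R(X,Y)$ that map $X_i$ into $Y_i$ for all $i\in W$, and $\mathbf{End}_R\,\mathbf{X}=\mathbf{Hom}_R(\mathbf{X},\mathbf{X})$. In $\mathbf{End}_R\,\mathbf{F}=R$, elements $r\in R$ are identified with the scalar multiplications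 $x\mapsto rx$. A generic extension is a forcing extension $V[G]$ of the universe $V$; $\mathbf{F}$ is the same object, while $\mathbf{End}_R\,\mathbf{F}$ is computed in $V[G]$. *)

(* Defs.v *)
From HB Require Import structures.
From mathcomp Require Import all_boot all_order all_algebra finmap.
From mathcomp Require Import boolp classical_sets cardinality.

Set Implicit Arguments.
Unset Strict Implicit.
Unset Printing Implicit Defensive.

Import Order.TTheory GRing.Theory.

Local Open Scope classical_set_scope.
Local Open Scope card_scope.
Local Open Scope ring_scope.

(* K -> (omega)^{<omega}.  Cardinals are represented by types, compared through
   the cardinality relation #<= of their full sets. *)
Definition erdos (K : choiceType) : Prop :=
  forall f : {fset K} -> bool,
  exists (X : set K) (g : nat -> bool),
    infinite_set X /\
    forall Y : {fset K}, [set` Y] `<=` X -> f Y = g #|` Y|.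

Definition is_kappa_omega (K : choiceType) : Prop :=
  erdos K /\ forall K' : choiceType, erdos K' -> [set: K] #<= [set: K'].

(* |T| < kappa(omega).  If no omega-Erdos cardinal exists, this is no
   restriction on T. *)
Definition below_kappa_omega (T : Type) : Prop :=
  forall K : choiceType, is_kappa_omega K ->
    [set: T] #<= [set: K] /\ ~ ([set: K] #<= [set: T]).

Section Modules.
Variable R : comNzRingType.

Definition is_basis (M : lmodType R) (I : choiceType) (b : I -> M) : Prop :=
  forall x : M, exists! c : {fsfun I -> R with 0},
    x = \sum_(i <- finsupp c) c i *: b i.

Definition free_of_rank (I : choiceType) (M : lmodType R) : Prop :=
  exists b : I -> M, is_basis b.

Definition free_module (M : lmodType R) : Prop :=
  exists I : choiceType, free_of_rank I M.

Section SubQuotient.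
Variables (M : lmodType R) (N : submodClosed M).

Definition submod : Type := {x : M | x \in N}.

HB.instance Definition _ := SubChoice.on submod.
HB.instance Definition _ := [SubChoice_isSubLmodule of submod by <:].

Local Open Scope quotient_scope.

(* submodClosed does not inherit from zmodClosed in MathComp. *)
Definition mem_submod : {pred M} := [in N].

Lemma mem_submod_zmod_closed : zmod_closed mem_submod.
Proof. exact: GRing.submod_closedB (submodClosedP N). Qed.

HB.instance Definition _ :=
  GRing.isZmodClosed.Build M mem_submod mem_submod_zmod_closed.

Definition quotmod : Type := Quotient.quot mem_submod.

HB.instance Definition _ := GRing.Zmodule.on quotmod.
HB.instance Definition _ := ZmodQuotient.on quotmod.

Definition quotmod_scale (r : R) (x : quotmod) : quotmod :=
  \pi_quotmod (r *: repr x).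

Lemma pi_eqE (x y : M) :
  (\pi_quotmod x == \pi_quotmod y :> quotmod) = (x - y \in N).
Proof. exact: esym (Quotient.idealrBE mem_submod x y). Qed.

Lemma pi_quotmodD (x y : M) :
  \pi_quotmod (x + y) = \pi_quotmod x + \pi_quotmod y.
Proof. exact: raddfD. Qed.

Lemma quotmod_scale_pi (r : R) (x : M) :
  quotmod_scale r (\pi_quotmod x) = \pi_quotmod (r *: x).
Proof.
apply/eqP; rewrite /quotmod_scale pi_eqE -scalerBr rpredZ //.
by rewrite -pi_eqE reprK.
Qed.

Lemma quotmod_scaleA (a b : R) (v : quotmod) :
  quotmod_scale a (quotmod_scale b v) = quotmod_scale (a * b) v.
Proof.
by elim/quotW: v => x; rewrite (quotmod_scale_pi b) (quotmod_scale_pi a)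
  (quotmod_scale_pi (a * b)) scalerA.
Qed.

Lemma quotmod_scale1 : left_id 1 quotmod_scale.
Proof. by elim/quotW=> x; rewrite (quotmod_scale_pi 1) scale1r. Qed.

Lemma quotmod_scaleDr : right_distributive quotmod_scale +%R.
Proof.
move=> a; elim/quotW=> x; elim/quotW=> y.
by rewrite -pi_quotmodD !(quotmod_scale_pi a) scalerDr pi_quotmodD.
Qed.

Lemma quotmod_scaleDl (v : quotmod) :
  {morph quotmod_scale^~ v : a b / a + b}.
Proof.
elim/quotW: v => x a b.
rewrite (quotmod_scale_pi (a + b)) (quotmod_scale_pi a) (quotmod_scale_pi b).
by rewrite scalerDl pi_quotmodD.
Qed.

HB.instance Definition _ := GRing.Zmodule_isLmodule.Build R quotmod
  quotmod_scaleA quotmod_scale1 quotmod_scaleDr quotmod_scaleDl.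

End SubQuotient.

(* <0,1> ^ L1 ^ L2 ^ L3: only the index set matters, its well-ordering plays no
   role in the notions below. *)
Inductive W : Type :=
  | W0 | W1
  | WL1 of nat * nat
  | WL2 of nat * nat
  | WL3 of nat * nat.

Record RomegaModule := MkRomegaModule {
  carrier :> lmodType R;
  dist : W -> submodClosed carrier }.

Definition free_Romega (X : RomegaModule) : Prop :=
  free_module X /\
  forall i : W, free_module (submod (dist X i)) /\ free_module (quotmod (dist X i)).

End Modules.

(* The forcing relation of a preordered forcing notion P, where q <= p means
   that q is stronger than p.  A statement of the forcing language is
   represented by the set of conditions that force it, so that [phi p] reads
   "p forces phi".  The variables of type T range over the elements of the
   ground model set T (i.e. their check names); a subset of such a set in V[G]
   is given by a name consisting of pairs (check x, p). *)
Section Forcing.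
Variables (d : Order.disp_t) (P : preorderType d).

Definition fstatement : Type := P -> Prop.

Definition fnot (phi : fstatement) : fstatement :=
  fun p => forall q : P, (q <= p)%O -> ~ phi q.

Definition fand (phi psi : fstatement) : fstatement :=
  fun p => phi p /\ psi p.

Definition fall (T : Type) (phi : T -> fstatement) : fstatement :=
  fun p => forall x : T, phi x p.

Definition fimp (phi psi : fstatement) : fstatement :=
  fnot (fand phi (fnot psi)).

Definition fiff (phi psi : fstatement) : fstatement :=
  fand (fimp phi psi) (fimp psi phi).

Definition fex (T : Type) (phi : T -> fstatement) : fstatement :=
  fnot (fall (fun x => fnot (phi x))).

(* For atomic (hence absolute) statements about elements of the ground model. *)
Definition fground (A : Prop) : fstatement := fun _ => A.

Definition subset_name (T : Type) : Type := T -> P -> Prop.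

(* p forces "check x in tau" iff the conditions below some r with
   (check x, r) in tau are dense below p. *)
Definition fmem (T : Type) (x : T) (tau : subset_name T) : fstatement :=
  fun p => forall q : P, (q <= p)%O ->
    exists s r : P, [/\ (s <= q)%O, (s <= r)%O & tau x r].

Section Endomorphisms.
Variable R : comNzRingType.

Definition fname (X Y : RomegaModule R) : Type := subset_name (X * Y)%type.

Definition ffunction (X Y : RomegaModule R) (tau : fname X Y) : fstatement :=
  fand (fall (fun x : X => fex (fun y : Y => fmem (x, y) tau)))
    (fall (fun x : X => fall (fun y : Y => fall (fun y' : Y =>
       fimp (fand (fmem (x, y) tau) (fmem (x, y') tau))
            (fground (y = y')))))).

Definition flinear (X Y : RomegaModule R) (tau : fname X Y) : fstatement :=
  fand
    (fall (fun x : X => fall (fun y : Y =>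
     fall (fun x' : X => fall (fun y' : Y =>
       fimp (fand (fmem (x, y) tau) (fmem (x', y') tau))
            (fmem (x + x', y + y') tau))))))
    (fall (fun r : R => fall (fun x : X => fall (fun y : Y =>
       fimp (fmem (x, y) tau) (fmem (r *: x, r *: y) tau))))).

(* tau maps X_i into Y_i for all i in W *)
Definition fpreserves (X Y : RomegaModule R) (tau : fname X Y) : fstatement :=
  fall (fun i : W => fall (fun x : X => fall (fun y : Y =>
    fimp (fand (fground (x \in dist X i)) (fmem (x, y) tau))
         (fground (y \in dist Y i))))).

Definition fHom (X Y : RomegaModule R) (tau : fname X Y) : fstatement :=
  fand (ffunction tau) (fand (flinear tau) (fpreserves tau)).

Definition fEnd (X : RomegaModule R) (tau : fname X X) : fstatement :=
  fHom tau.

(* tau = (x |-> r x) *)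
Definition fscalar (X : RomegaModule R) (r : R) (tau : fname X X) :
    fstatement :=
  fall (fun x : X => fall (fun y : X =>
    fiff (fmem (x, y) tau) (fground (y = r *: x)))).

(* End X = R, where r in R is identified with x |-> r x: the endomorphisms are
   exactly the scalar multiplications, and, unless X = 0, distinct scalars give
   distinct endomorphisms. *)
Definition fEnd_eq_R (X : RomegaModule R) : fstatement :=
  fand
    (fall (fun tau : fname X X =>
       fiff (fEnd tau) (fex (fun r : R => fscalar r tau))))
    (fimp (fex (fun x : X => fground (x <> 0)))
       (fall (fun r : R => fall (fun s : R =>
          fimp (fall (fun x : X => fground (r *: x = s *: x)))
               (fground (r = s)))))).

End Endomorphisms.

End Forcing.

(* A statement holds in all V[G], G generic for P over V, iff every condition
   of P forces it. *)
Definition End_eq_R_in_any_generic_extension (R : comNzRingType)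
    (X : RomegaModule R) : Prop :=
  forall (d : Order.disp_t) (P : preorderType d) (p : P),
    fEnd_eq_R X p.

(* Main.v *)
Require Import Defs.
From HB Require Import structures.
From mathcomp Require Import all_boot all_order all_algebra finmap.
From mathcomp Require Import boolp classical_sets functions cardinality wochoice.

(* If Lambda is infinite, index a basis (e_t) of F by the tree of finite
   sequences of elements of Lambda, and let the distinguished submodules be the
   spans of {e_t : t in P} for countably many sets P of sequences, together with,
   for each n, the span of the e_t - e_(parent t) with t of length n + 1.  An
   endomorphism phi commutes with parents level by level and respects every P,
   so if s is in the support of phi(e_t) and t' is a child of t, then some child
   s' of s is in the support of phi(e_t').

   Suppose s <> t occurs.  After well-ordering Lambda, let a_0 be the least last
   entry of a t in which such a pair (t, s) differs, and let a_1 > a_0 be the last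
   entry of s.  Taking children by a_1, then by the resulting a_2, and so on,
   gives a sequence which plays the role of the critical sequence of an
   elementary embedding with critical point a_0.  As Lambda < kappa(omega) there
   is a colouring f without infinite homogeneous set; choosing the sets P to
   record f and its indiscernibility relations makes the sequence homogeneous
   for f, a contradiction.  Hence phi(e_t) = r_t e_t, and r_t does not depend on
   t since phi respects the e_t - e_(parent t).

   For phi in a forcing extension the same game is played in V by strengthening
   conditions, and the sequence it produces lies in V. *)

Set Implicit Arguments.
Unset Strict Implicit.
Unset Printing Implicit Defensive.

Import Order.TTheory GRing.Theory.

Local Open Scope classical_set_scope.
Local Open Scope card_scope.

(** * Cardinal arithmetic *)

Lemma card_leT_injP (T U : Type) :
  ([set: T] #<= [set: U]) <-> exists f : T -> U, injective f.
Proof.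
split=> [/card_leP[f]|[f f_inj]].
  exists (fun x => val (f (SigSub (mem_set (I : [set: T] x))))).
  by move=> x y /val_inj /(inj (mem_set I) (mem_set I)) [].
have [g fg] : {g : {inj [set: T] >-> U} | f = g}.
  by apply: Pinj => x y _ _; exact: f_inj.
by apply/inj_card_le; exact: [fun of totalfun_ [set: T] g].
Qed.

(* Zorn's lemma, applied to sets of choice functions of the family any two of
   which differ at every index, gives a maximal such set; it must exhaust
   some member of the family. *)
Lemma min_card_exists (T : Type) (F : set (set T)) : F !=set0 ->
  exists2 A, F A & forall B, F B ->
    exists2 f : T -> T, (forall x, A x -> B (f x)) & set_inj A f.
Proof.
move=> [A0 FA0].
pose P (S : set (set T -> T)) :=
  (forall s A, S s -> F A -> A (s A)) /\
  (forall s s' A, S s -> S s' -> F A -> s A = s' A -> s = s').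
have [|S [[S1 S2] Smax]] := @Zorn_bigcup _ P.
  move=> C CP Ctot; split=> [s A [X CX Xs] FA|s s' A [X CX Xs] [Y CY Ys'] FA].
    exact: (CP _ CX).1 _ _ Xs FA.
  have [XY|YX] := Ctot _ _ CX CY.
    exact: (CP _ CY).2 _ _ _ (XY _ Xs) Ys' FA.
  exact: (CP _ CX).2 _ _ _ Xs (YX _ Ys') FA.
have [A FA Aex] : exists2 A, F A & forall a, A a -> exists2 s, S s & s A = a.
  apply: contrapT => noA.
  have missed A : F A -> exists a, A a /\ forall s, S s -> s A <> a.
    move=> FA; apply: contrapT => nexa; apply: noA; exists A => // a Aa.
    apply: contrapT => nexs; apply: nexa; exists a; split=> // s Ss sa.
    by apply: nexs; exists s.
  have [a0 _] := missed _ FA0.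
  (* [s0] picks in each member of [F] a point that no [s] in [S] takes there, so it could be added
     to [S]; off [F] the value [a0] is a default. *)
  pose s0 A := if pselect (F A) is left FA then sval (cid (missed A FA)) else a0.
  have s0P A : F A -> A (s0 A) /\ forall s, S s -> s A <> s0 A.
    move=> FA; rewrite /s0; case: pselect => // FA'.
    by case: (cid (missed A FA')).
  apply: (Smax (S `|` [set s0])).
    split=> [|sub]; first by left.
    have Ss0 : S s0 by apply: sub; right.
    by have [_ /(_ _ Ss0)] := s0P _ FA0.
  split=> [s A [Ss|->] FA|s s' A [Ss|->] [Ss'|->] FA //].
  - exact: S1 _ _ Ss FA.
  - by have [] := s0P _ FA.
  - exact: S2 _ _ _ Ss Ss' FA.
  - by have [_ /(_ _ Ss)] := s0P _ FA.
  - by have [_ /(_ _ Ss') ne /esym] := s0P _ FA.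
exists A => // B FB.
pose f a := if pselect (A a) is left Aa then (s2val (cid2 (Aex a Aa))) B else a.
have fP a : A a -> exists s, [/\ S s, s A = a & f a = s B].
  move=> Aa; rewrite /f; case: pselect => // Aa'.
  by case: (cid2 (Aex a Aa')) => s Ss sA; exists s.
exists f => [a /fP[s [Ss _ ->]]|a a' /set_mem/fP[s [Ss sA ->]]
    /set_mem/fP[s' [Ss' s'A ->]]].
  exact: S1 _ _ Ss FB.
by rewrite -sA -s'A => /(S2 _ _ _ Ss Ss' FB) ->.
Qed.

Lemma set_inj_total (T : Type) (A B : set T) :
  (exists2 f : T -> T, (forall x, A x -> B (f x)) & set_inj A f) \/
  (exists2 f : T -> T, (forall x, B x -> A (f x)) & set_inj B f).
Proof.
have [|C CAB Cmin] := @min_card_exists T [set X | X = A \/ X = B].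
  by exists A; left.
case: CAB => ->{C} in Cmin; [left; apply: Cmin|right; apply: Cmin].
  by right.
by left.
Qed.

(** Both types sit inside [T + U], where [set_inj_total] compares two subsets of a single type. *)
Lemma inj_total (T U : Type) :
  (exists f : T -> U, injective f) \/ (exists f : U -> T, injective f).
Proof.
have [[f fP f_inj]|[f fP f_inj]] := set_inj_total (range (@inl T U)) (range inr).
  have /choice[g gP] (x : T) : exists y : U, f (inl x) = inr y.
    by have [y _ <-] := fP (inl x) (imageP _ I); exists y.
  left; exists g => x y gxy.
  suff: inl x = inl y :> T + U by case.
  by apply: f_inj; rewrite ?inE; [exists x|exists y|rewrite !gP gxy].
have /choice[g gP] (x : U) : exists y : T, f (inr x) = inl y.
  by have [y _ <-] := fP (inr x) (imageP _ I); exists y.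
right; exists g => x y gxy.
suff: inr x = inr y :> T + U by case.
by apply: f_inj; rewrite ?inE; [exists x|exists y|rewrite !gP gxy].
Qed.

Lemma inj_bij (T U : Type) (f : T -> U) (g : U -> T) :
  injective f -> injective g -> exists h : T -> U, bijective h.
Proof.
move=> f_inj g_inj.
have /card_eqP[h] : [set: T] #= [set: U].
  by apply: Cantor_Bernstein; apply/card_leT_injP; [exists f|exists g].
pose i x := SigSub (mem_set (I : [set: T] x)).
have h_inj : injective (fun x => val (h (i x))).
  by move=> x y /val_inj /(inj (mem_set I) (mem_set I)) [].
exists (fun x => val (h (i x))).
have /choice[k kK] (y : U) : exists x, val (h (i x)) = y.
  have [x _ hx] :=
    'surj_h (I : [set: set_type [set: U]] (SigSub (mem_set (I : [set: U] y)))).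
  exists (val x); rewrite (_ : i _ = x) ?hx //.
  by apply: val_inj.
exists k => // x; apply: h_inj; exact: kK.
Qed.

(** * Pairing functions on infinite sets *)

Section Square.
Variable T : Type.
Implicit Types (G H : set (T * T * T)).

Let dom G : set T := [set x | exists z, G (x, x, z)].

Let pairing_graph G :=
  [/\ forall p z z', G (p, z) -> G (p, z') -> z = z',
      forall p p' z, G (p, z) -> G (p', z) -> p = p',
      forall x y z, G (x, y, z) -> [/\ dom G x, dom G y & dom G z] &
      forall x y, dom G x -> dom G y -> exists z, G (x, y, z)].

(** Zorn's lemma gives a maximal injection [g] from [D * D] to [D], where [D = dom G]. Either the
    complement of [D] injects into [D], and then so does [T], or [D] injects into its complement and
    [g] can be extended. *)
Lemma square_inj : infinite_set [set: T] -> exists p : T * T -> T, injective p.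
Proof.
move/infiniteP/card_leT_injP => [e e_inj].
pose G0 : set (T * T * T) :=
  [set w | exists m n, w = (e m, e n, e (choice.pickle (m, n)))].
have G0ok : pairing_graph G0.
  have D0 n : dom G0 (e n) by exists (e (choice.pickle (n, n))), n, n.
  split=> [p z z' [m [n [-> ->]]] [m' [n' [/e_inj -> /e_inj -> ->]]]
          |p p' z [m [n [-> ->]]] [m' [n' [->]]]
          |x y z [m [n [-> -> ->]]]|x y [z [m [? [-> _ _]]]] [? [n [? [-> _ _]]]]] //.
    by move/e_inj/(pcan_inj choice.pickleK) => [-> ->].
  by exists (e (choice.pickle (m, n))), m, n.
(* Adjoining [G0] makes the union of the empty chain admissible and keeps infinitely many tags [e n]
   in the domain. *)
have [|H [Hok Hmax]] := @Zorn_bigcup _ [set H | pairing_graph (G0 `|` H)].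
  move=> F Fok Ftot.
  set U := \bigcup_(X in F) X.
  have two w w' : (G0 `|` U) w -> (G0 `|` U) w' ->
      exists K, [/\ pairing_graph K, K `<=` G0 `|` U, K w & K w'].
    have FU X : F X -> G0 `|` X `<=` G0 `|` U.
      by move=> FX w0 [?|Xw]; [left|right; exists X].
    move=> [Gw|[X FX Xw]] [Gw'|[Y FY Yw']].
    - by exists G0; split=> // ?; left.
    - by exists (G0 `|` Y); split; [exact: Fok|exact: FU|left|right].
    - by exists (G0 `|` X); split; [exact: Fok|exact: FU|right|left].
    - have [XY|YX] := Ftot _ _ FX FY.
      + by exists (G0 `|` Y); split; [exact: Fok|exact: FU|right; exact: XY|right].
      + by exists (G0 `|` X); split; [exact: Fok|exact: FU|right|right; exact: YX].
  have domS K : K `<=` G0 `|` U -> dom K `<=` dom (G0 `|` U).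
    by move=> KU x [z Kz]; exists z; exact: KU.
  split=> [p z z' h h'|p p' z h h'|x y z h|x y [z h] [z' h']].
  - by have [K [[+ _ _ _] _ hK h'K]] := two _ _ h h'; apply; eauto.
  - by have [K [[_ + _ _] _ hK h'K]] := two _ _ h h'; apply; eauto.
  - have [K [[_ _ + _] KU hK _]] := two _ _ h h.
    by move=> /(_ _ _ _ hK)[? ? ?]; split; apply: (domS K).
  - have [K [[_ _ _ +] KU hK h'K]] := two _ _ h h'.
    move=> /(_ x y) []; [by exists z|by exists z'|].
    by move=> z'' ?; exists z''; exact: KU.
set G := G0 `|` H in Hok.
case: Hok => [Gfun Ginj Gdom Gtot].
have eD n : dom G (e n).
  by exists (e (choice.pickle (n, n))); left; exists n, n.
have [g gP] : exists g : T * T -> T, forall x y, dom G x -> dom G y -> G (x, y, g (x, y)).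
  suff /choice[g gP] : forall p : T * T, exists z, dom G p.1 -> dom G p.2 -> G (p, z).
    by exists g => x y; exact: (gP (x, y)).
  move=> [x y]; have [[Dx Dy]|nD] := pselect (dom G x /\ dom G y).
    by have [z] := Gtot _ _ Dx Dy; exists z.
  by exists (e 0) => Dx Dy; case: nD.
have gD x y : dom G x -> dom G y -> dom G (g (x, y)).
  by move=> Dx Dy; have [] := Gdom _ _ _ (gP _ _ Dx Dy).
have g_inj x y x' y' : dom G x -> dom G y -> dom G x' -> dom G y' ->
    g (x, y) = g (x', y') -> (x, y) = (x', y').
  move=> Dx Dy Dx' Dy' gxy; apply: Ginj (gP _ _ Dx Dy) _.
  by rewrite gxy; exact: gP.
have [[f fD f_inj]|[f fD f_inj]] := set_inj_total (dom G) (~` dom G); last first.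
  have [h hD h_inj] : exists2 h : T -> T, (forall x, dom G (h x)) & injective h.
    exists (fun x => if pselect (dom G x) is left _ then g (x, e 0) else g (f x, e 1)).
      by move=> x; case: pselect => Dx; apply: gD => //; exact: fD.
    have fD' x (nDx : ~ dom G x) : dom G (f x) := fD x nDx.
    move=> x y; case: pselect => Dx; case: pselect => Dy.
    - by case/(g_inj _ _ _ _ Dx (eD 0) Dy (eD 0)).
    - by case/(g_inj _ _ _ _ Dx (eD 0) (fD' _ Dy) (eD 1)) => _ /e_inj.
    - by case/(g_inj _ _ _ _ (fD' _ Dx) (eD 1) Dy (eD 0)) => _ /e_inj.
    - case/(g_inj _ _ _ _ (fD' _ Dx) (eD 1) (fD' _ Dy) (eD 1)).
      by apply: f_inj; rewrite inE.
  exists (fun p => g (h p.1, h p.2)) => -[x y] [x' y'] /=.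
  by case/(g_inj _ _ _ _ (hD x) (hD y) (hD x') (hD y')) => /h_inj -> /h_inj ->.
exfalso.
pose pt (i : bool) a := if i then f a else a.
(* The pairs over [D] and [f(D)] that are not in [D * D] form three blocks, tagged by [i + j.*2] in
   1, 2, 3; all are coded into [f(D)], which is disjoint from [D]. *)
pose N : set (T * T * T) := [set w | exists i j a b, [/\ i || j, dom G a, dom G b &
   w = (pt i a, pt j b, f (g (e (i + j.*2), g (a, b))))]].
have ptD i a : dom G a -> dom G (pt i a) -> i = false.
  by case: i => //= /fD.
have pt_inj i j a b : dom G a -> dom G b -> pt i a = pt j b -> i = j /\ a = b.
  case: i j => [] [] //= Da Db.
  - by move/f_inj => -> //; rewrite inE.
  - by move=> fab; case: (fD _ Da); rewrite fab.
  - by move=> fab; case: (fD _ Db); rewrite -fab.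
have domN : dom (G0 `|` (H `|` N)) = dom G `|` [set f a | a in dom G].
  rewrite setUA -/G; apply/seteqP; split=> [x [z []]|x [[z]|[a Da <-]]].
  - by left; exists z.
  - move=> [i [j [a [b [ij Da Db [-> _ _]]]]]].
    by case: i ij => /= _; [right; exists a|left].
  - by exists z; left.
  - by exists (f (g (e 3, g (a, a)))); right; exists true, true, a, a.
have fE a b : dom G a -> dom G b -> f a = f b -> a = b.
  by move=> Da Db; apply: f_inj; rewrite inE.
have ptD' i a : dom G a -> (dom G `|` [set f a | a in dom G]) (pt i a).
  by case: i => Da; [right; exists a|left].
apply: (Hmax (H `|` N)).
  split=> [|sub]; first by left.
  have : H (f (e 0), f (e 0), f (g (e 3, g (e 0, e 0)))).
    by apply: sub; right; exists true, true, (e 0), (e 0).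
  by move=> Hf; apply: (fD _ (eD 0)); eexists; right; exact: Hf.
rewrite /= /pairing_graph domN setUA -/G; split.
- move=> p z z' [Gp|[i [j [a [b [ij Da Db [-> ->]]]]]]]
    [Gp'|[i' [j' [a' [b' [ij' Da' Db' [e1 e2]]]]]]].
  + exact: Gfun Gp Gp'.
  + move: Gp; rewrite e1 => /Gdom[/(ptD _ _ Da') i'F /(ptD _ _ Db') j'F _].
    by rewrite i'F j'F in ij'.
  + move: Gp' => /Gdom[/(ptD _ _ Da) iF /(ptD _ _ Db) jF _].
    by rewrite iF jF in ij.
  + have [ii aa] := pt_inj _ _ _ _ Da Da' e1.
    have [jj bb] := pt_inj _ _ _ _ Db Db' e2.
    by move=> ->; rewrite ii jj aa bb.
- move=> p p' z [Gp|[i [j [a [b [ij Da Db [-> ->]]]]]]]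
    [Gp'|[i' [j' [a' [b' [ij' Da' Db' [e1 e2]]]]]]].
  + exact: Ginj Gp Gp'.
  + case: p Gp => x y /Gdom[_ _]; rewrite e2.
    by move/(fD _ (gD _ _ (eD _) (gD _ _ Da' Db'))).
  + case: p' Gp' => x y /Gdom[_ _].
    by move/(fD _ (gD _ _ (eD _) (gD _ _ Da Db))).
  + have Dg := gD _ _ Da Db; have Dg' := gD _ _ Da' Db'.
    have De := eD (i + j.*2); have De' := eD (i' + j'.*2).
    move: e2 => /(fE _ _ (gD _ _ De Dg) (gD _ _ De' Dg')).
    move=> /(g_inj _ _ _ _ De Dg De' Dg')[/e_inj ij_eq].
    move=> /(g_inj _ _ _ _ Da Db Da' Db')[aa bb].
    rewrite e1 aa bb.
    by case: i j i' j' {ij ij' De De' e1} ij_eq => [] [] [] [].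
- move=> x y z [/Gdom[Dx Dy Dz]|[i [j [a [b [ij Da Db [-> -> ->]]]]]]].
    by split; left.
  split; [exact: ptD'|exact: ptD'|right].
  by exists (g (e (i + j.*2), g (a, b))) => //; exact: gD (eD _) (gD _ _ Da Db).
- have split_pt x : (dom G `|` [set f a | a in dom G]) x ->
      exists i a, dom G a /\ x = pt i a.
    by move=> [Dx|[a Da <-]]; [exists false, x|exists true, a].
  move=> x y /split_pt[i [a [Da ->]]] /split_pt[j [b [Db ->]]].
  have [ij|] := boolP (i || j).
    by exists (f (g (e (i + j.*2), g (a, b)))); right; exists i, j, a, b.
  by rewrite negb_or => /andP[/negPf -> /negPf ->]; exists (g (a, b)); left; exact: gP.
Qed.

(** A sequence is coded by iterated pairing of its entries. The length is recorded too, because the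
    end marker [e 0] may itself be the code of a pair. *)
Lemma seq_bij : infinite_set [set: T] -> exists h : T -> seq T, bijective h.
Proof.
move=> Tinf; have [p p_inj] := square_inj Tinf.
have /infiniteP/card_leT_injP[e e_inj] := Tinf.
pose code := foldr (fun x c => p (x, c)) (e 0).
apply: (@inj_bij _ _ (fun x => [:: x]) (fun s => p (e (size s), code s))).
  by move=> x y [].
move=> s t /p_inj[/e_inj]; elim: s t => [|x s IH] [|y t] //= [sz].
by move=> /p_inj[-> /(IH _ sz) ->].
Qed.

End Square.

(** * The Erdős property and cardinals below the first Erdős cardinal *)

Lemma erdos_inj (K L : choiceType) (h : K -> L) : injective h ->
  erdos K -> erdos L.
Proof.
move=> h_inj K_erdos f.
have [X [g [Xinf Xg]]] := K_erdos (fun Y => f (h @` Y)%fset).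
exists (h @` X), g; split.
  move=> fin; apply: Xinf.
  by rewrite -(eq_finite_set (@inj_card_eq _ _ X h (in2W h_inj))).
move=> Y YX.
have /choice[k kP] (y : L) : exists x : option K,
    (h @` X) y -> exists z, [/\ x = Some z, X z & h z = y].
  have [[x Xx <-]|no] := pselect ((h @` X) y).
    by exists (Some x) => _; exists x; split.
  by exists None => /no.
pose Y' := [fset x | x in pmap k Y]%fset.
have Y'P x : x \in Y' <-> X x /\ h x \in Y.
  rewrite !inE /= mem_pmap; split=> [/mapP[y yY kx]|[Xx hxY]].
    by have [z []] := kP y (YX _ yY); rewrite -kx => -[->] Xz ->.
  apply/mapP; exists (h x) => //.
  by have [|z [-> _ /h_inj ->]] := kP (h x); first exact: imageP.
have YE : Y = (h @` Y')%fset.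
  apply/fsetP => y; apply/idP/imfsetP => [yY|[x /Y'P[_ hx] ->] //].
  by have [x Xx xy] := YX _ yY; exists x; rewrite /= -?xy //; apply/Y'P; rewrite xy.
by rewrite {1}YE (Xg Y') ?YE ?card_imfset //= => x /Y'P[].
Qed.

(** If [T] had the property, a subset [A] of least size having it would be the first Erdős cardinal,
    and [A] embeds in [T]. *)
Lemma below_kappa_omega_not_erdos (T : choiceType) :
  below_kappa_omega T -> ~ erdos T.
Proof.
move=> Tbelow Terdos.
have [|A Aerdos Amin] :=
    @min_card_exists T [set A | erdos (set_type A : choiceType)].
  exists [set: T].
  apply: (@erdos_inj T [set: T] (fun x => SigSub (mem_set (I : [set: T] x))))
    Terdos => x y.
  exact: (congr1 val).
have AT : exists f : A -> T, injective f by exists val; exact: val_inj.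
suff Akappa : is_kappa_omega (set_type A : choiceType).
  by have [_] := Tbelow _ Akappa; apply; apply/card_leT_injP.
split=> // K Kerdos; apply/card_leT_injP.
(* If [K] embeds in [A], its image is again an Erdős subset of [T], to which the minimality of [A]
   applies. *)
have [//|[h h_inj]] := inj_total A K.
have val_h_inj : injective (fun x => val (h x)) by move=> x y /val_inj/h_inj.
have Berdos : erdos (set_type (range (fun x => val (h x))) : choiceType).
  apply: (@erdos_inj K (range (fun x => val (h x)))
    (fun x => SigSub (mem_set (imageP (fun x => val (h x)) (I : [set: K] x)))))
    Kerdos => x y xy.
  exact: val_h_inj (congr1 val xy).
have [f fB f_inj] := Amin _ Berdos.
have /choice[k kP] (a : A) : exists x : K, val (h x) = f (val a).
  by have [x _ <-] := fB _ (set_mem (valP a)); exists x.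
exists k => a b kab; apply: val_inj; apply: f_inj; try exact: valP.
by rewrite -!kP kab.
Qed.

(** * Simulations of the tree of finite sequences *)

(** Totality, antisymmetry and transitivity of [R] are read off from minima of sets with at most
    three elements. *)
Lemma strict_well_order_exists (T : eqType) : exists lt : T -> T -> Prop,
  [/\ forall x, ~ lt x x, forall y x z, lt x y -> lt y z -> lt x z,
      forall x y, [\/ lt x y, x = y | lt y x] &
      forall A : set T, A !=set0 -> exists2 m, A m & forall x, lt x m -> ~ A x].
Proof.
have [R Rwo] := well_ordering_principle T.
have Rmin (A : set T) : A !=set0 -> exists2 m, A m & forall x, A x -> R m x.
  move=> [a Aa]; have [|m [[/asboolP Am mP] _]] := Rwo [pred x | `[< A x >]].
    by exists a; apply/asboolP.
  by exists m => // x Ax; apply: mP; apply/asboolP.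
have Rtotal x y : R x y \/ R y x.
  have [|m [->|->] mP] := Rmin [set z | z = x \/ z = y]; first by exists x; left.
    by left; apply: mP; right.
  by right; apply: mP; left.
have Ranti x y : R x y -> R y x -> x = y.
  move=> xy yx.
  have [|z [_ zP]] := Rwo [pred z | (z == x) || (z == y)].
    by exists x; rewrite inE eqxx.
  have Rxx : R x x by have [] := Rtotal x x.
  have Ryy : R y y by have [] := Rtotal y y.
  by transitivity z; [symmetry|]; apply: zP; split;
    rewrite ?inE ?eqxx ?orbT // => w; rewrite inE => /orP[] /eqP ->.
have Rtrans y x z : R x y -> R y z -> R x z.
  move=> xy yz; have [|m mE mP] := Rmin [set w | [\/ w = x, w = y | w = z]].
    by exists x; constructor.
  have := mP x (Or31 _ _ erefl); have := mP y (Or32 _ _ erefl).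
  have := mP z (Or33 _ _ erefl).
  case: mE => -> //; first by move=> _ _ yx; rewrite (Ranti _ _ xy yx).
  by move=> _ zy _; rewrite -(Ranti _ _ yz zy).
exists (fun x y => ~ R y x); split.
- by move=> x; apply; have [] := Rtotal x x.
- move=> y x z nyx nzy zx; apply: nyx; apply: (Rtrans z) => //.
  by have [|/nzy] := Rtotal y z.
- move=> x y; have [yx|] := pselect (R y x); last by constructor.
  have [xy|] := pselect (R x y); last by constructor.
  by constructor 2; exact: Ranti.
- by move=> A /Rmin[m Am mP]; exists m => // x nmx /mP.
Qed.

(* The levelled trees below are given by a level and a parent function; the
   parent of a node of level 0 is a junk value. *)
Section Simulation.
Variables (I J : Type) (lev : I -> nat) (par : I -> I) (P : J -> I -> Prop).

(** The combinatorial trace of an endomorphism: [L t s] stands for [s] occurring in the support of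
    the image of the basis element at [t]. The fields reflect the submodules for levels, for the
    properties [P] and for the edges. *)
Record simulation (L : I -> I -> Prop) : Prop := Simulation {
  sim_lev : forall t s, L t s -> lev t = lev s;
  sim_prop : forall j t s, P j t -> L t s -> P j s;
  sim_child : forall t s t', L t s -> lev t' = (lev t).+1 -> par t' = t ->
    exists s', [/\ lev s' = (lev s).+1, par s' = s & L t' s'] }.

Definition sim_rigid : Prop :=
  forall L, simulation L -> forall t s, L t s -> t = s.

End Simulation.

Section SequenceTree.
Variable T : choiceType.
Variables (lt : T -> T -> Prop) (f : {fset T} -> bool).
Hypothesis lt_irr : forall x, ~ lt x x.
Hypothesis lt_trans : forall y x z, lt x y -> lt y z -> lt x z.
Hypothesis lt_total : forall x y, [\/ lt x y, x = y | lt y x].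

Definition seq_parent (t : seq T) : seq T := take (size t).-1 t.

Definition fseq (s : seq T) : bool := f [fset x in s]%fset.

(* The parameters z stand for the points fixed by the endomorphism, below its
   critical point x; quantifying over them here lets the relation, once true of
   the critical sequence, be shifted to parameters below later terms. *)
Definition shift_indiscernible (x : T) (s : seq T) : Prop :=
  forall z, (forall y, y \in z -> lt y x) ->
    fseq (z ++ belast x s) = fseq (z ++ s).

(** Feature 0 makes the critical sequence increase, 1 gives [lt a0 a1], and 2 recovers equality of
    entries at the end. Simulations carry features in one direction only, hence both 3 and 4 for the
    colour. *)
Definition seq_feature (j : nat) (t : seq T) : Prop :=
  if t is x :: s then
    match j with
    | 0 => lt x (last x s)
    | 1 => lt (last x s) x
    | 2 => last x s = x
    | 3 => fseq t
    | 4 => ~~ fseq t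
    | _ => shift_indiscernible x s
    end
  else False.

(** Passing to tails lets a feature compare the last entry with the entry at any given position. The
    pairs of indices match those of [WL1]. *)
Definition tail_feature (j : nat * nat) (t : seq T) : Prop :=
  seq_feature j.2 (drop j.1 t).

Lemma fseq_catC s t : fseq (s ++ t) = fseq (t ++ s).
Proof.
by rewrite /fseq; congr f; apply/fsetP => x; rewrite !inE /= orbC.
Qed.

Lemma belast_map_iota (a : nat -> T) k n :
  belast (a k) (map a (iota k.+1 n)) = map a (iota k n).
Proof. by elim: n k => //= n IH k; rewrite IH. Qed.

Lemma seq_parent_rcons t a : seq_parent (rcons t a) = t.
Proof. by rewrite /seq_parent size_rcons /= -cats1 take_size_cat. Qed.

Lemma seq_parent_size t n : size t = n.+1 ->
  exists2 a, t = rcons (seq_parent t) a & size (seq_parent t) = n.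
Proof.
case/lastP: t => // t a; rewrite size_rcons => -[tn].
by exists a; rewrite seq_parent_rcons.
Qed.

(** * A homogeneous set from a least moved element *)

Section Indiscernibles.
Variable L : seq T -> seq T -> Prop.
Hypothesis L_sim : simulation size seq_parent tail_feature L.

Lemma L_size t s : L t s -> size t = size s.
Proof. exact: sim_lev L_sim _ _. Qed.

Lemma L_child t s a : L t s -> exists b, L (rcons t a) (rcons s b).
Proof.
move=> Lts; have [||s' [s'lev s'par Ls']] := sim_child L_sim (t' := rcons t a) Lts.
- by rewrite size_rcons.
- exact: seq_parent_rcons.
by have [b bE _] := seq_parent_size s'lev; exists b; rewrite -s'par -bE.
Qed.

Lemma L_feature j u t v s : size u = size v -> L (u ++ t) (v ++ s) ->
  seq_feature j t -> seq_feature j s.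
Proof.
move=> uv Lts jt.
have := sim_prop L_sim (j := (size u, j)) _ Lts.
by rewrite /tail_feature /= drop_size_cat // uv drop_size_cat //; apply.
Qed.

Lemma L_fseq u t v s : size u = size v -> L (u ++ t) (v ++ s) ->
  fseq t = fseq s.
Proof.
move=> uv Lts.
have sz : size t = size s.
  by have := L_size Lts; rewrite !size_cat uv => /addnI.
case: t s Lts sz => [|x t] [|y s] // Lts _.
have := L_feature (j := 3) uv Lts; have := L_feature (j := 4) uv Lts => /=.
by case: (fseq (x :: t)) => [_ ->|/(_ isT)/negPf ->].
Qed.

Definition moved (a : T) : Prop :=
  exists u v b, [/\ size u = size v, L (rcons u a) (rcons v b) & b <> a].

Variable a0 : T.
Hypothesis a0_min : forall x, lt x a0 -> ~ moved x.

Lemma L_below t s x : L t s -> lt x a0 -> L (rcons t x) (rcons s x).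
Proof.
move=> Lts xa0; have [b Lb] := L_child x Lts.
have [bx|bx] := pselect (b = x); first by rewrite -{2}bx.
by case: (a0_min xa0); exists t, s, b; split => //; exact: L_size Lts.
Qed.

Lemma L_cat_below t s z : L t s -> (forall y, y \in z -> lt y a0) ->
  L (t ++ z) (s ++ z).
Proof.
elim: z t s => [|y z IH] t s Lts zP; first by rewrite !cats0.
rewrite -!cat_rcons; apply: IH => [|y' y'z]; last by apply: zP; rewrite inE y'z orbT.
by apply: L_below => //; apply: zP; rewrite inE eqxx.
Qed.

Variables (u v : seq T) (a1 : T).
Hypothesis uv_size : size u = size v.
Hypothesis L01 : L (rcons u a0) (rcons v a1).
Hypothesis a10 : a1 <> a0.

(** If [a1] were below [a0] it would be unmoved, so it could be appended on both sides. The tail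
    [[:: a0; a1]] then has feature 1, but its counterpart [[:: a1; a1]] does not. *)
Lemma lt_a0_a1 : lt a0 a1.
Proof.
case: (lt_total a0 a1) => [//|/esym//|a1a0].
have := L_below L01 a1a0; rewrite -!cats1 -!catA /= => /(L_feature (j := 1) uv_size).
by move=> /(_ a1a0) /lt_irr.
Qed.

Lemma critical_sequence : exists a : nat -> T, [/\ a 0 = a0, a 1 = a1 &
  forall n, L (u ++ map a (iota 0 n.+1)) (v ++ map a (iota 1 n.+1))].
Proof.
(* The left tail is [a0 :: z] without its last entry, that is, the right tail [z] delayed by one.
   Appending [last a0 z] on the left yields the next term as the answer on the right. *)
pose inv z := L (u ++ belast a0 z) (v ++ z).
have next z : inv z -> exists b, inv (rcons z b).
  move=> Lz; have [b] := L_child (last a0 z) Lz; exists b.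
  by rewrite /inv belast_rcons lastI -!rcons_cat.
have /choice[nxt nxtP] z : exists b, inv z -> inv (rcons z b).
  have [/next[b ?]|] := pselect (inv z); first by exists b.
  by exists a0.
pose stage n := iter n (fun z => rcons z (nxt z)) [:: a1].
have stageP n : inv (stage n).
  elim: n => [|n]; last exact: nxtP.
  by rewrite /inv /= !cats1.
exists (fun n => last a0 (if n is m.+1 then stage m else [::])); split=> // n.
set a := fun n => _.
have stageE m : stage m = map a (iota 1 m.+1).
  elim: m => [//|m IH]; rewrite -[m.+2]addn1 iotaD map_cat -IH /= cats1.
  by congr rcons; rewrite /a /= last_rcons.
have := stageP n; rewrite /inv stageE.
by rewrite -[a0]/(a 0) belast_map_iota.
Qed.

Lemma indiscernibles : exists (X : set T) (g : nat -> bool),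
  infinite_set X /\
  forall Y : {fset T}, [set` Y] `<=` X -> f Y = g #|` Y|.
Proof.
have [a [a0E a1E La]] := critical_sequence.
(* In [La (k + m)] the first [k] terms join the prefixes [u] and [v], and what remains are the two
   blocks compared here. *)
have shift j k m : seq_feature j (map a (iota k m.+1)) ->
    seq_feature j (map a (iota k.+1 m.+1)).
  move=> jk; have := La (k + m).
  rewrite -addnS !iotaD !map_cat !catA add0n add1n => /(L_feature (j := j)).
  by apply=> //; rewrite !size_cat !size_map !size_iota uv_size.
have a_lt1 k : lt (a k) (a k.+1).
  elim: k => [|k IH]; first by rewrite a0E a1E; exact: lt_a0_a1.
  exact: (shift 0 k 1).
have a_lt i j : (i < j)%N -> lt (a i) (a j).
  elim: j => // j IH; rewrite ltnS leq_eqVlt => /orP[/eqP -> //|/IH ij].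
  exact: lt_trans ij (a_lt1 _).
have a_inj : injective a.
  move=> i j aij; have [/a_lt|/a_lt|//] := ltngtP i j; rewrite aij => /lt_irr [].
(* For [k = 0] the parameters lie below the critical point, so they can be appended unchanged to
   both sides of [La]. Feature 5 quantifies over parameters, and [shift] then carries it to every
   [k]. *)
have indisc k m z : (forall y, y \in z -> lt y (a k)) ->
    fseq (z ++ map a (iota k m)) = fseq (z ++ map a (iota k.+1 m)).
  suff: seq_feature 5 (map a (iota k m.+1)).
    by move=> /= + zk => /(_ z zk); rewrite belast_map_iota.
  elim: k {z} => [|k IH]; last exact: shift.
  rewrite /= /shift_indiscernible belast_map_iota a0E => z z0.
  case: m => [|m]; first by [].
  have := L_cat_below (La m) z0; rewrite -!catA => /(L_fseq uv_size).
  by rewrite !(fseq_catC _ z).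
have indisc_iter k i m z : (k <= i)%N -> (forall y, y \in z -> lt y (a k)) ->
    fseq (z ++ map a (iota k m)) = fseq (z ++ map a (iota i m)).
  move=> /subnKC <-; elim: (i - k) => [|d IH] zk; first by rewrite addn0.
  rewrite IH // addnS indisc // => y /zk yk.
  have [->|d0] := posnP d; first by rewrite addn0.
  by apply: lt_trans yk _; apply: a_lt; rewrite -addn1 leq_add2l.
(* The first term [a i] joins the parameters, the remaining terms are compressed to the block
   starting at [i.+1], and [indisc_iter] slides the whole block back to [k]. *)
have homog I z k : sorted ltn I -> (forall i, i \in I -> (k <= i)%N) ->
    (forall y, y \in z -> lt y (a k)) ->
    fseq (z ++ map a I) = fseq (z ++ map a (iota k (size I))).
  elim: I z k => [//|i I IH] z k /= iI kI zk.
  have ki : (k <= i)%N by apply: kI; rewrite inE eqxx.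
  rewrite -[a k :: _]/(map a (iota k (size I).+1)) (@indisc_iter k i) //=.
  rewrite -!cat_rcons (IH _ i.+1) ?(path_sorted iI) // => [j jI|y].
    exact: (allP (order_path_min ltn_trans iI)).
  rewrite mem_rcons inE => /orP[/eqP ->|/zk yk]; first exact: a_lt1.
  by apply: lt_trans yk _; apply: a_lt; rewrite ltnS.
exists (range a), (fun n => fseq (map a (iota 0 n))); split.
  apply/infiniteP.
  by rewrite (card_le_eqr (@inj_card_eq _ _ [set: nat] a (in2W a_inj))).
move=> Y YX.
have /choice[idx idxP] (y : T) : exists i, y \in Y -> a i = y.
  have [/YX[i _ <-]|_] := boolP (y \in Y); first by exists i.
  by exists 0.
pose I := sort leq (map idx Y).
have YE : Y = [fset x in map a I]%fset.
  apply/fsetP => y; rewrite !inE; apply/idP/mapP => [yY|[i]].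
    by exists (idx y); rewrite ?idxP // mem_sort map_f.
  by rewrite mem_sort => /mapP[y' y'Y ->] ->; rewrite idxP.
have Iu : sorted ltn I.
  rewrite ltn_sorted_uniq_leq sort_sorted ?andbT; last exact: leq_total.
  rewrite sort_uniq map_inj_in_uniq ?fset_uniq // => y y' yY y'Y yy'.
  by rewrite -(idxP _ yY) -(idxP _ y'Y) yy'.
rewrite {1}YE -/(fseq (map a I)) (homog _ [::] 0) //.
by rewrite size_sort size_map.
Qed.

End Indiscernibles.

End SequenceTree.

(** The features are built from a well-order and a colouring without infinite homogeneous set; a
    least moved element would produce such a set. *)
Lemma seq_tree_rigid (T : choiceType) : ~ erdos T ->
  exists P : nat * nat -> seq T -> Prop, sim_rigid size (@seq_parent T) P.
Proof.
move=> Tnot; have [lt [irr trans total wf]] := strict_well_order_exists T.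
have [f fP] : exists f : {fset T} -> bool, ~ exists (X : set T) (g : nat -> bool),
    infinite_set X /\ forall Y : {fset T}, [set` Y] `<=` X -> f Y = g #|` Y|.
  apply: contrapT => nof; apply: Tnot => f; apply: contrapT => nX.
  by apply: nof; exists f.
exists (tail_feature lt f) => L Lsim.
have nomoved a : ~ moved L a.
  move=> a_moved; have [|a0 [u [v [a1 [uv L01 a10]]]] a0min] := wf (moved L).
    by exists a.
  exact: fP (indiscernibles irr trans total Lsim a0min uv L01 a10).
move=> t s Lts; have ts := L_size Lsim Lts.
(* Since nothing is moved, any [a] can be appended to both sides. Taking for [a] the entry of [t] at
   position [i], feature 2 of the tail from [i] forces [s] to have the same entry there. *)
have last_eq a : L (rcons t a) (rcons s a).
  have [b Lb] := L_child Lsim a Lts.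
  have [ba|ba] := pselect (b = a); first by rewrite -{2}ba.
  by case: (nomoved a); exists t, s, b.
case: t => [|x0 t] in Lts ts last_eq *; first by case: s ts {last_eq Lts}.
apply: (@eq_from_nth _ x0 (x0 :: t) s) => // i it.
have it' : (i < size s)%N by rewrite -ts.
have := last_eq (nth x0 (x0 :: t) i).
rewrite -{1}(cat_take_drop i (x0 :: t)) -{1}(cat_take_drop i s) !rcons_cat.
have sz : size (take i (x0 :: t)) = size (take i s) by rewrite !size_take_min ts.
move=> /(L_feature Lsim (j := 2) sz).
by rewrite (drop_nth x0 it) (drop_nth x0 it') /= !last_rcons; apply.
Qed.

Local Open Scope ring_scope.
Local Open Scope quotient_scope.

(** * Bases and coordinates *)

Lemma to_linear (R : pzRingType) (M N : lmodType R) (f : M -> N) : linear f ->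
  exists g : {linear M -> N}, g =1 f.
Proof.
move=> f_lin; pose m := GRing.isLinear.Build _ _ _ _ f f_lin.
by pose g : {linear M -> N} := HB.pack f m; exists g.
Qed.

Section DualSystem.
Variables (R : comNzRingType) (M : lmodType R) (I : choiceType).

(** A basis together with its coordinate functionals; finite support and joint injectivity of the
    [e i] replace spanning. In this form supports and spans are expressed by linear maps. *)
Definition dual_system (b : I -> M) (e : I -> {linear M -> R^o}) : Prop :=
  [/\ forall i j, e i (b j) = (i == j)%:R,
      forall x, exists S : {fset I}, forall i, e i x != 0 -> i \in S &
      forall x, (forall i, e i x = 0) -> x = 0].

Lemma sum_finsupp (N : lmodType R) (c : {fsfun I -> R with 0}) (S : {fset I})
    (v : I -> N) : {subset finsupp c <= S} ->
  \sum_(i <- finsupp c) c i *: v i = \sum_(i <- S) c i *: v i.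
Proof.
move=> cS; apply: big_fset_incl; first exact/fsubsetP.
by move=> i _ /fsfun_dflt ->; rewrite scale0r.
Qed.

Lemma sum_delta (S : {fset I}) (c : I -> R) (j : I) :
  (c j != 0 -> j \in S) -> \sum_(i <- S) c i * (j == i)%:R = c j.
Proof.
move=> jS; have [jin|jnin] := boolP (j \in S).
  rewrite (big_fsetD1 j) //= eqxx mulr1 big1_seq ?addr0 // => i /andP[_].
  by rewrite !inE => /andP[/negPf ij _]; rewrite eq_sym ij mulr0.
have /eqP -> : c j == 0 by apply: contraNT jnin => /jS.
rewrite big1_seq // => i /andP[_ iS].
by case: eqP => [ji|_]; rewrite ?mulr0 //; rewrite ji iS in jnin.
Qed.

Lemma dual_system_is_basis b e : dual_system b e -> is_basis b.
Proof.
move=> [eb efin e0] x; have [S xS] := efin x.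
pose c : {fsfun I -> R with 0} := [fsfun i in S => (e i x : R) | 0].
have cE i : c i = e i x.
  rewrite fsfunE; case: ifP => // iS.
  by apply/esym/eqP; apply: contraFT iS => /xS.
exists c; split.
  rewrite (@sum_finsupp _ c S) => [|i]; last first.
    by rewrite mem_finsupp cE => /xS.
  apply/eqP; rewrite -subr_eq0; apply/eqP; apply: e0 => j.
  rewrite linearB linear_sum /=.
  under eq_bigr do rewrite linearZ eb cE /=.
  by rewrite [X in _ - X](@sum_delta S (fun i => e i x)) ?subrr // => /xS.
move=> c' xE; apply/fsfunP => j; rewrite cE xE linear_sum /=.
under eq_bigr do rewrite linearZ eb /=.
by rewrite [LHS](@sum_delta _ c') // mem_finsupp.
Qed.

Lemma is_basis_dual_system (b : I -> M) : is_basis b -> exists e, dual_system b e.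
Proof.
move=> b_basis.
have /choice[c cP] x : exists c : {fsfun I -> R with 0},
    x = \sum_(i <- finsupp c) c i *: b i /\
    forall c' : {fsfun I -> R with 0},
      x = \sum_(i <- finsupp c') c' i *: b i -> c = c'.
  by have [c [cx c_uniq]] := b_basis x; exists c.
have cE x (S : {fset I}) (d : I -> R) : (forall i, i \notin S -> d i = 0) ->
    x = \sum_(i <- S) d i *: b i -> forall i, c x i = d i.
  move=> dS xE; pose d' : {fsfun I -> R with 0} := [fsfun i in S => d i | 0].
  have d'E i : d' i = d i by rewrite fsfunE; case: ifPn => // /dS.
  suff -> : c x = d' by [].
  have [_] := cP x; apply; rewrite (@sum_finsupp _ d' S) => [|i].
    by rewrite xE; apply: eq_bigr => i _; rewrite d'E.
  by rewrite mem_finsupp d'E; apply: contraNT => /dS ->.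
have cS x (S : {fset I}) : {subset finsupp (c x) <= S} ->
    x = \sum_(i <- S) c x i *: b i.
  by move=> xS; rewrite -sum_finsupp //; have [] := cP x.
have c_lin i : linear (fun x => c x i : R^o).
  move=> a x y; pose S := (finsupp (c x) `|` finsupp (c y))%fset.
  apply: (cE _ S (fun i => a * c x i + c y i)) => [j|].
    rewrite inE negb_or => /andP[/fsfun_dflt -> /fsfun_dflt ->].
    by rewrite mulr0 addr0.
  rewrite {1}(cS x S) => [|j jx]; last by rewrite inE jx.
  rewrite {1}(cS y S) => [|j jy]; last by rewrite inE jy orbT.
  rewrite scaler_sumr -big_split; apply: eq_bigr => j _ /=.
  by rewrite scalerDl scalerA.
have /choice[e eE] i := to_linear (c_lin i).
exists e; split=> [i j|x|x ex].
- rewrite eE; apply: (cE _ [fset j]%fset (fun k => (k == j)%:R)) => [k|].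
    by rewrite inE => /negPf ->.
  by rewrite big_seq_fset1 eqxx scale1r.
- by exists (finsupp (c x)) => i; rewrite eE mem_finsupp.
- have [-> _] := cP x; rewrite big1_seq // => i _.
  by have := ex i; rewrite eE => ->; rewrite scale0r.
Qed.

Section Coordinates.
Variables (b : I -> M) (e : I -> {linear M -> R^o}).
Hypothesis be : dual_system b e.

Lemma dual_expand x (S : {fset I}) : (forall i, e i x != 0 -> i \in S) ->
  x = \sum_(i <- S) e i x *: b i.
Proof.
case: be => eb _ e0 xS; apply/eqP; rewrite -subr_eq0; apply/eqP; apply: e0 => j.
rewrite linearB linear_sum /=.
under eq_bigr do rewrite linearZ eb /=.
by rewrite [X in _ - X](@sum_delta S (fun i => e i x)) ?subrr // => /xS.
Qed.

Lemma eq_on_support (N : lmodType R) (g h : {linear M -> N}) x :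
  (forall i, e i x != 0 -> g (b i) = h (b i)) -> g x = h x.
Proof.
move=> gh; have [S xS] : exists S : {fset I}, forall i, e i x != 0 -> i \in S.
  by case: be.
rewrite (dual_expand xS) !linear_sum; apply: eq_bigr => i _; rewrite !linearZ /=.
by have [->|/gh -> //] := eqVneq (e i x : R) 0; rewrite !scale0r.
Qed.

Lemma dual_coord_ext x y : (forall i, e i x = e i y) -> x = y.
Proof.
case: be => _ _ e0 xy; apply/eqP; rewrite -subr_eq0; apply/eqP; apply: e0 => i.
by rewrite linearB /= xy subrr.
Qed.

Lemma dual_extend (N : lmodType R) (v : I -> N) :
  exists g : {linear M -> N}, forall i, g (b i) = v i.
Proof.
have [eb efin _] := be; have /choice[S SP] := efin.
pose g x := \sum_(i <- S x) e i x *: v i.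
have gE x (A : {fset I}) : (forall i, e i x != 0 -> i \in A) ->
    g x = \sum_(i <- A) e i x *: v i.
  move=> xA; pose B := (S x `|` A)%fset.
  have sum0 (C : {fset I}) : (C `<=` B)%fset ->
      (forall i, e i x != 0 -> i \in C) ->
      \sum_(i <- C) e i x *: v i = \sum_(i <- B) e i x *: v i.
    move=> CB xC; apply: big_fset_incl => // i _ iC.
    have /eqP -> : (e i x : R) == 0 by apply: contraNT iC => /xC.
    by rewrite scale0r.
  by rewrite /g (sum0 _ (fsubsetUl _ _) (SP x)) (sum0 _ (fsubsetUr _ _) xA).
have g_lin : linear g.
  move=> a x y; pose A := (S x `|` S y)%fset.
  rewrite !(gE _ A) => [|i /SP|i /SP|i].
  - rewrite scaler_sumr -big_split; apply: eq_bigr => i _ /=.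
    by rewrite linearP scalerDl scalerA.
  - by rewrite inE => ->; rewrite orbT.
  - by rewrite inE => ->.
  - rewrite inE linearP; apply: contraNT; rewrite negb_or => /andP[ix iy].
    have /eqP -> : e i x == 0 by apply: contraNT ix => /SP.
    have /eqP -> : e i y == 0 by apply: contraNT iy => /SP.
    by rewrite scaler0 addr0.
have [h hg] := to_linear g_lin; exists h => j.
rewrite hg (gE _ [fset j]%fset) => [|i]; last first.
  by rewrite eb inE; case: (i == j); rewrite ?eqxx.
by rewrite big_seq_fset1 eb eqxx scale1r.
Qed.

End Coordinates.

Implicit Types (e : I -> {linear M -> R^o}) (S : I -> Prop).

(** When [e] is dual to a basis, this is the span of the basis elements indexed by [S], described by
    vanishing coordinates. *)
Definition basis_span (e : I -> {linear M -> R^o}) (S : I -> Prop) : {pred M} :=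
  [pred x | `[< forall i, ~ S i -> e i x = 0 >]].

Lemma basis_spanP e S x :
  reflect (forall i, ~ S i -> e i x = 0) (x \in basis_span e S).
Proof. exact: asboolP. Qed.

Lemma basis_span_submod_closed e S : GRing.submod_closed (basis_span e S).
Proof.
split=> [|a x y /basis_spanP xS /basis_spanP yS]; apply/basis_spanP => i Si.
  by rewrite linear0.
by rewrite linearP /= xS // yS // scaler0 addr0.
Qed.

HB.instance Definition _ (e : I -> {linear M -> R^o}) (S : I -> Prop) :=
  GRing.isSubmodClosed.Build R M (basis_span e S)
    (GRing.submod_closed_semi (basis_span_submod_closed e S)).

End DualSystem.

Section FreeSubmodule.
Variables (R : comNzRingType) (M : lmodType R) (I : choiceType).
Implicit Types (e : I -> {linear M -> R^o}) (S : I -> Prop).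

Lemma sub_pi (N : submodClosed M) (i : I) e x :
  (forall y, y \in N -> e i y = 0) ->
  e i (repr (\pi_(quotmod N) x)) = e i x.
Proof.
move=> eN; apply/eqP; rewrite -subr_eq0 -linearB /= eN //.
by rewrite -pi_eqE reprK.
Qed.

(** The basis splits: the part over [S] is a basis of [N], and the part over the complement maps to
    a basis of the quotient, since its functionals vanish on [N]. *)
Lemma free_basis_span b e S : dual_system b e ->
  let N : submodClosed M := basis_span e S in
  free_module (submod N) /\ free_module (quotmod N).
Proof.
move=> [eb efin e0] N; split.
  pose J : choiceType := {i : I | `[< S i >]}.
  have bN (j : J) : b (val j) \in N.
    apply/basis_spanP => i Si; rewrite eb; case: eqP => // ij.
    by case: Si; rewrite ij; apply/asboolP; exact: valP j.
  exists J, (fun j => exist _ (b (val j)) (bN j) : submod N).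
  pose e' (j : J) : {linear submod N -> R^o} := e (val j) \o val.
  apply: (@dual_system_is_basis _ _ _ _ e'); split=> [i j|x|x ex].
  - by rewrite /= eb.
  - have [A xA] := efin (val x).
    exists [fset j in pmap insub A]%fset => j /xA jA.
    by rewrite inE /= mem_pmap_sub.
  - apply: val_inj; apply: e0 => i; have [Si|Si] := pselect (S i).
      exact: (ex (exist _ i (asboolT Si))).
    by have /basis_spanP := valP x; apply.
pose J : choiceType := {i : I | `[< ~ S i >]}.
have eN (j : J) y : y \in N -> e (val j) y = 0.
  by move/basis_spanP; apply; apply/asboolP; exact: valP j.
have epi (j : J) x : e (val j) (repr (\pi_(quotmod N) x)) = e (val j) x.
  by apply: sub_pi => y; exact: eN.
have /choice[e' e'E] (j : J) : exists g : {linear quotmod N -> R^o},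
    forall x, g (\pi_(quotmod N) x) = e (val j) x.
  have [|g gE] := @to_linear R (quotmod N) R^o (fun q => e (val j) (repr q)).
    move=> a; elim/quotW=> x; elim/quotW=> y.
    rewrite [a *: _]quotmod_scale_pi -pi_quotmodD.
    by rewrite !epi linearP.
  by exists g => x; rewrite gE epi.
exists J, (fun j => \pi_(quotmod N) (b (val j))).
apply: (@dual_system_is_basis _ _ _ _ e'); split=> [i j|x|].
- by rewrite e'E eb.
- elim/quotW: x => x; have [A xA] := efin x.
  exists [fset j in pmap insub A]%fset => j; rewrite e'E => /xA jA.
  by rewrite inE /= mem_pmap_sub.
- elim/quotW=> x ex.
  have <- : \pi_(quotmod N) 0 = 0 by exact: raddf0.
  apply/eqP; rewrite pi_eqE subr0.
  apply/basis_spanP => i Si.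
  by have := ex (exist _ i (asboolT Si)); rewrite e'E.
Qed.

End FreeSubmodule.

Section Shear.
Variables (R : comNzRingType) (M : lmodType R) (I : choiceType).
Variables (b : I -> M) (e : I -> {linear M -> R^o}) (A : pred I) (p : I -> I).
Hypothesis be : dual_system b e.
Hypothesis pA : forall t, A t -> ~~ A (p t).

Definition shear_basis (t : I) : M := if A t then b t - b (p t) else b t.

(** As [p] leaves [A], subtracting [b (p t)] over [A] is undone by adding it back, so the new family
    is a basis with functionals [e i \o u]. This puts the differences along edges of the tree into a
    basis, which makes their span a [basis_span]. *)
Lemma shear_dual_system : exists (e' : I -> {linear M -> R^o}) (u : {linear M -> M}),
  [/\ dual_system shear_basis e', forall i x, e' i x = e i (u x) &
      forall t, u (b t) = if A t then b t + b (p t) else b t].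
Proof.
have [u uE] := dual_extend be (fun t => if A t then b t + b (p t) else b t).
have [w wE] := dual_extend be shear_basis.
have uw x : u (w x) = x.
  apply: (eq_on_support be (g := u \o w) (h := idfun)) => t _ /=.
  rewrite wE /shear_basis; case: ifP => At; last by rewrite uE At.
  by rewrite linearB /= !uE At (negPf (pA At)) addrK.
have wu x : w (u x) = x.
  apply: (eq_on_support be (g := w \o u) (h := idfun)) => t _ /=.
  rewrite uE; case: ifP => At; last by rewrite wE /shear_basis At.
  by rewrite linearD /= !wE /shear_basis At (negPf (pA At)) subrK.
exists (fun i => e i \o u), u; split=> //; case: be => eb efin e0.
split=> [i j|x|x ex] /=.
- by rewrite -wE uw eb.
- by have [S xS] := efin (u x); exists S.
- by rewrite -[x]wu (e0 (u x)) ?linear0.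
Qed.

End Shear.

(** * Forcing *)

Section ForcingRelation.
Variables (d : Order.disp_t) (Q : preorderType d).
Implicit Types (p q r : Q) (phi psi : fstatement Q).

Lemma fimpP phi psi p : fimp phi psi p <->
  forall q, (q <= p)%O -> phi q -> exists2 r, (r <= q)%O & psi r.
Proof.
split=> [H q qp phiq|H q qp [/(H _ qp)[r rq psir] /(_ r rq)]]; last exact.
apply: contrapT => no; apply: (H q qp); split=> // r rq psir.
by apply: no; exists r.
Qed.

Lemma fexP (T : Type) (phi : T -> fstatement Q) p : fex phi p <->
  forall q, (q <= p)%O -> exists x, exists2 r, (r <= q)%O & phi x r.
Proof.
split=> [H q qp|H q qp no].
  apply: contrapT => no; apply: (H q qp) => x r rq phir.
  by apply: no; exists x, r.
by have [x [r rq phir]] := H q qp; exact: no x r rq phir.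
Qed.

Lemma fmem_mono (T : Type) (x : T) (tau : subset_name Q T) p q :
  (q <= p)%O -> fmem x tau p -> fmem x tau q.
Proof. by move=> qp xp r rq; apply: xp; exact: le_trans qp. Qed.

(** This turns the dense conclusions supplied by [fimpP] into membership forced by the condition
    itself. *)
Lemma fmem_dense (T : Type) (x : T) (tau : subset_name Q T) p :
  (forall q, (q <= p)%O -> exists2 r, (r <= q)%O & fmem x tau r) -> fmem x tau p.
Proof.
move=> H q qp; have [r rq xr] := H q qp.
have [s [w [sr sw xw]]] := xr r (lexx r).
by exists s, w; split=> //; exact: le_trans rq.
Qed.

Variables (R : comNzRingType) (X : RomegaModule R).
Implicit Types tau : fname Q X X.

(* From the point of view of V, an endomorphism in V[G] is a family of partial
   linear maps indexed by the conditions and growing along the forcing order;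
   each element is in the domain for a dense set of conditions. *)
Record decided_End tau p : Prop := DecidedEnd {
  dec_total : forall x q, (q <= p)%O ->
    exists y, exists2 r, (r <= q)%O & fmem (x, y) tau r;
  dec_fun : forall x y y' q, (q <= p)%O ->
    fmem (x, y) tau q -> fmem (x, y') tau q -> y = y';
  dec_add : forall x y x' y' q, (q <= p)%O ->
    fmem (x, y) tau q -> fmem (x', y') tau q -> fmem (x + x', y + y') tau q;
  dec_scale : forall a x y q, (q <= p)%O ->
    fmem (x, y) tau q -> fmem (a *: x, a *: y) tau q;
  dec_pres : forall i x y q, (q <= p)%O ->
    x \in dist X i -> fmem (x, y) tau q -> y \in dist X i }.

Lemma fEndP tau p : fEnd tau p <-> decided_End tau p.
Proof.
split=> [[[tot fun_] [[add scale] pres]]|[tot fun_ add scale pres]].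
  split.
  - by move=> x; apply/fexP; exact: tot.
  - move=> x y y' q qp xy xy'.
    by have [|r _] := (fimpP _ _ _).1 (fun_ x y y') q qp.
  - move=> x y x' y' q qp xy xy'; apply: fmem_dense => r rq.
    apply: ((fimpP _ _ _).1 (add x y x' y') r (le_trans rq qp)).
    by split; [exact: fmem_mono rq xy|exact: fmem_mono rq xy'].
  - move=> a x y q qp xy; apply: fmem_dense => r rq.
    exact: ((fimpP _ _ _).1 (scale a x y) r (le_trans rq qp) (fmem_mono rq xy)).
  - move=> i x y q qp xi xy.
    by have [|r _] := (fimpP _ _ _).1 (pres i x y) q qp.
split; [split|split; [split|]].
- by move=> x; apply/fexP; exact: tot.
- by move=> x y y'; apply/fimpP => q qp [xy xy']; exists q; last exact: fun_ qp xy xy'.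
- by move=> x y x' y'; apply/fimpP => q qp [xy xy']; exists q => //; exact: add.
- by move=> a x y; apply/fimpP => q qp xy; exists q => //; exact: scale.
- by move=> i x y; apply/fimpP => q qp [xi xy]; exists q; last exact: pres qp xi xy.
Qed.

Lemma decided_End_mono tau p q : (q <= p)%O -> decided_End tau p -> decided_End tau q.
Proof.
move=> qp [tot fun_ add scale pres]; have le r : (r <= q)%O -> (r <= p)%O.
  by move=> rq; exact: le_trans qp.
split.
- by move=> x r /le; exact: tot.
- by move=> x y y' r /le; exact: fun_.
- by move=> x y x' y' r /le; exact: add.
- by move=> a x y r /le; exact: scale.
- by move=> i x y r /le; exact: pres.
Qed.

Lemma fscalarP a tau p : fscalar a tau p <->
  forall q x y, (q <= p)%O -> fmem (x, y) tau q <-> y = a *: x.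
Proof.
split=> [H q x y qp|H x y].
  have [/fimpP H1 /fimpP H2] := H x y; split=> [xy|yE].
    by have [] := H1 q qp xy.
  by apply: fmem_dense => r rq; apply: H2 => //; exact: le_trans qp.
split; apply/fimpP => q qp.
  by move=> xy; exists q => //; exact/(H q).
by move=> xy; exists q => //; exact/(H q).
Qed.

Lemma fscalar_decided_End a tau p : fscalar a tau p -> decided_End tau p.
Proof.
move/fscalarP => H; split.
- by move=> x q qp; exists (a *: x), q => //; exact/(H q).
- by move=> x y y' q qp /(H q) -> // /(H q) ->.
- by move=> x y x' y' q qp /(H q) -> // /(H q) -> //; apply/(H q); rewrite // scalerDr.
- move=> c x y q qp /(H q) -> //; apply/(H q) => //.
  by rewrite !scalerA mulrC.
- by move=> i x y q qp xi /(H q) -> //; rewrite rpredZ.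
Qed.

Lemma dec_sum (I : eqType) (v : I -> X) (c : I -> R) (s : seq I) a tau p :
  decided_End tau p ->
  (forall i q, (q <= p)%O -> exists2 r, (r <= q)%O & fmem (v i, a *: v i) tau r) ->
  fmem (\sum_(i <- s) c i *: v i, a *: \sum_(i <- s) c i *: v i) tau p.
Proof.
move=> tau_End va; elim: s => [|i s IH].
  rewrite big_nil scaler0; apply: fmem_dense => q qp.
  (* Whatever value [y] is decided for the image of 0, scaling by 0 turns the pair into [(0, 0)]. *)
  have [y [r rq /(dec_scale tau_End 0)]] := dec_total tau_End 0 qp.
  by rewrite !scale0r => H; exists r => //; apply: H; exact: le_trans qp.
rewrite big_cons scalerDr; apply: (dec_add tau_End) => //.
rewrite scalerA mulrC -scalerA; apply: (dec_scale tau_End) => //.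
by apply: fmem_dense => q; exact: va.
Qed.

End ForcingRelation.

(** * The module attached to a rigid levelled tree *)

Section TreeModule.
Variables (R : comNzRingType) (F : lmodType R) (I : choiceType) (b : I -> F).
Variables (lev : I -> nat) (par : I -> I) (P : nat * nat -> I -> Prop).
Hypothesis b_basis : is_basis b.
Hypothesis lev_par : forall t n, lev t = n.+1 -> lev (par t) = n.
Hypothesis root_uniq : forall t s, lev t = 0%N -> lev s = 0%N -> t = s.
Hypothesis rigid : sim_rigid lev par P.

Theorem tree_module_End : exists Fi : W -> submodClosed F,
  let FF := MkRomegaModule Fi in
  free_Romega FF /\ End_eq_R_in_any_generic_extension FF.
Proof.
have [e be] := is_basis_dual_system b_basis.
have shear_n n := @shear_dual_system R F I b e (fun t => lev t == n.+1) par be.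
have /choice[eu euP] n : exists eu : (I -> {linear F -> R^o}) * {linear F -> F},
    [/\ dual_system (shear_basis b (fun t => lev t == n.+1) par) eu.1,
        forall i x, eu.1 i x = e i (eu.2 x) &
        forall t, eu.2 (b t) = if lev t == n.+1 then b t + b (par t) else b t].
  have [|e' [u H]] := shear_n n; last by exists (e', u).
  by move=> t /eqP /lev_par ->; rewrite ltn_eqF.
(* [WL1] carries the properties, [WL2] the levels and [WL3] the edges, the last two repeated along
   the second index; [W0] and [W1] receive the zero submodule. *)
pose Fi (w : W) : submodClosed F := match w with
  | WL1 jk => basis_span e (P jk)
  | WL2 n => basis_span e (fun t => lev t = n.1)
  | WL3 n => basis_span (eu n.1).1 (fun t => lev t = n.1.+1)
  | _ => basis_span e (fun=> False)
  end.
exists Fi => FF; split.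
  split; first by exists I, b.
  case=> [||jk|n|n]; try exact: free_basis_span be.
  by have [+ _ _] := euP n.1; exact: free_basis_span.
move=> d Q p.
pose lvl n : F -> Prop := fun x => x \in dist FF (WL2 (n, 0%N)).
have lvlP n x : lvl n x -> forall i, lev i <> n -> e i x = 0.
  by move/basis_spanP.
have eb i j : e i (b j) = (i == j)%:R by have [+ _ _] := be.
have b_mem (S : I -> Prop) t : S t -> b t \in basis_span e S.
  move=> St; apply/basis_spanP => i Si; rewrite eb.
  by case: eqP => // it; rewrite it in Si.
have edge_mem n t : lev t = n.+1 -> b t - b (par t) \in dist FF (WL3 (n, 0%N)).
  move=> tn; have [[e'b' _ _] _ _] := euP n; apply/basis_spanP => i it.
  have := e'b' i t; rewrite /shear_basis tn eqxx => ->.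
  by case: eqP => // ie; rewrite ie in it.
have edge_coord n x s : x \in dist FF (WL3 (n, 0%N)) -> lev s <> n.+1 ->
    e s ((eu n).2 x) = 0.
  by have [_ <- _] := euP n; move/basis_spanP; exact.
have uE n t : (eu n).2 (b t) = if lev t == n.+1 then b t + b (par t) else b t.
  by have [] := euP n.
have main tau q : decided_End (X := FF) (Q := Q) tau q ->
    exists a, exists2 r, (r <= q)%O & fscalar a tau r.
  move=> tau_End.
  have sub_dec x y x' y' r : (r <= q)%O -> fmem (x, y) tau r ->
      fmem (x', y') tau r -> fmem (x - x', y - y') tau r.
    move=> rq xy /(dec_scale tau_End (-1) rq); rewrite !scaleN1r.
    exact: dec_add tau_End _ _ _ _ _ rq xy.
  (* [L t s] holds if s may occur in the support of the image of t.  It lies in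
     V, so no absoluteness argument about V[G] is needed. *)
  pose L t s := exists r y, [/\ (r <= q)%O, fmem (b t, y) tau r & e s y != 0].
  have L_pres w (S : I -> Prop) t s : dist FF w = basis_span e S ->
      S t -> L t s -> S s.
    move=> wS St [r [y [rq ty sy]]]; apply: contrapT => Ss.
    have : y \in dist FF w.
      by apply: (dec_pres tau_End rq _ ty); rewrite wS; exact: b_mem.
    by rewrite wS => /basis_spanP /(_ s Ss) sy0; rewrite sy0 eqxx in sy.
  have L_lev t s : L t s -> lev s = lev t.
    exact: (L_pres (WL2 (lev t, 0%N)) (fun s => lev s = lev t)).
  have L_sim : simulation lev par P L.
    split=> [t s /L_lev //|jk t s Pt Lts|t s t' Lts t'_lev t'_par].
      exact: (L_pres (WL1 jk) (P jk) t).
    have s_lev := L_lev _ _ Lts.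
    have [r [y [rq ty sy]]] := Lts.
    have [y' [r' r'r ty']] := dec_total tau_End (b t') rq.
    have r'q := le_trans r'r rq.
    have edge : y' - y \in dist FF (WL3 (lev t, 0%N)).
      apply: (dec_pres tau_End r'q (edge_mem _ t' t'_lev)).
      by rewrite t'_par; apply: sub_dec => //; exact: fmem_mono ty.
    have s_ne : lev s <> (lev t).+1 by rewrite s_lev => /n_Sn.
    (* The map [(eu (lev t)).2] sends [y' - y] to an element without coordinate at [s]. It fixes [y]
       and adds to each basis element in [y'] its parent, so the nonzero coordinate of [y] at [s]
       must be cancelled by some child of [s] in the support of [y']. *)
    have := edge_coord _ _ s edge s_ne; rewrite !linearB /=.
    have -> : (eu (lev t)).2 y = y.
      apply: (eq_on_support be (h := idfun)) => i yi; rewrite uE.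
      have -> : lev i = lev t by apply: L_lev; exists r, y.
      by rewrite ltn_eqF.
    move=> sub0; apply: contrapT => no.
    suff y'0 : e s ((eu (lev t)).2 y') = 0.
      by move: sub0 sy; rewrite y'0 sub0r => /eqP; rewrite oppr_eq0 => ->.
    apply: (eq_on_support be (g := e s \o (eu (lev t)).2) (h := \0)) => i y'i /=.
    have Lti : L t' i by exists r', y'.
    have i_lev : lev i = (lev t).+1 by rewrite (L_lev _ _ Lti).
    rewrite uE i_lev eqxx linearD /= !eb.
    case: eqP => [si|_]; first by rewrite si in s_ne.
    case: eqP => [si|_]; last by rewrite addr0.
    by case: no; exists i; rewrite s_lev.
  have diag t y r : (r <= q)%O -> fmem (b t, y) tau r -> y = e t y *: b t.
    move=> rq ty; apply: (dual_coord_ext be) => s; rewrite linearZ /= eb.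
    have [->|st] := eqVneq s t; first by rewrite [RHS]mulr1.
    rewrite [RHS]mulr0; apply/eqP; apply: contraNT st => sy.
    by apply/eqP/esym; apply: (rigid L_sim); exists r, y.
  have [a [q' q'q aP]] : exists a, exists2 q', (q' <= q)%O &
      forall t r y, (r <= q')%O -> fmem (b t, y) tau r -> y = a *: b t.
    have [[t0 t0_lev]|noroot] := pselect (exists t, lev t = 0%N); last first.
      exists 0, q => // t; suff [] : False.
      move tn : (lev t) => n; elim: n t tn => [|n IH] t tn.
        by apply: noroot; exists t.
      exact: IH (lev_par tn).
    have [y0 [q' q'q t0y0]] := dec_total tau_End (b t0) (lexx q).
    exists (e t0 y0), q' => // t; move tn : (lev t) => n.
    elim: n t tn => [|n IH] t tn r y rq' ty; have rq := le_trans rq' q'q.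
      rewrite (root_uniq tn t0_lev) in ty *.
      rewrite -(diag _ _ _ q'q t0y0).
      exact: dec_fun tau_End _ _ _ _ rq ty (fmem_mono rq' t0y0).
    have [y' [r' r'r ty']] := dec_total tau_End (b (par t)) rq.
    have y'E := IH _ (lev_par tn) _ _ (le_trans r'r rq') ty'.
    have r'q := le_trans r'r rq.
    have edge : y - y' \in dist FF (WL3 (n, 0%N)).
      apply: (dec_pres tau_End r'q (edge_mem _ t tn)).
      by apply: sub_dec => //; exact: fmem_mono ty.
    have par_ne : lev (par t) <> n.+1 by rewrite (lev_par tn) => /n_Sn.
    have := edge_coord _ _ _ edge par_ne.
    rewrite y'E (diag _ _ _ rq ty) linearB !linearZ /= !uE tn eqxx.
    rewrite (lev_par tn) ltn_eqF // linearD !linearZ linearD linearN /= !eb eqxx.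
    case: eqP => [tt|_]; first by rewrite {1}tt tn in par_ne.
    rewrite add0r => ca0; have {ca0} : e t y * 1 + e t0 y0 * - 1 = 0 := ca0.
    by rewrite mulr1 mulrN1 => /eqP; rewrite subr_eq0 => /eqP ->.
  exists a, q' => //; apply/fscalarP => r x y rq'.
  have [S xS] : exists S : {fset I}, forall i, e i x != 0 -> i \in S.
    by case: be.
  have rq := le_trans rq' q'q.
  have xax : fmem (x, a *: x) tau r.
    rewrite {1 2}(dual_expand be xS).
    apply: dec_sum => [|i s sr]; first exact: decided_End_mono tau_End.
    have [y' [s' s's ty']] := dec_total tau_End (b i) (le_trans sr rq).
    exists s' => //; rewrite -(aP _ _ _ _ ty') //.
    exact: le_trans s's (le_trans sr rq').
  by split=> [xy|->//]; exact: dec_fun tau_End _ _ _ _ rq xy xax.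
split.
- move=> tau; split; apply/fimpP => q qp.
    move/fEndP => tau_End; exists q => //; apply/fexP => r rq.
    exact: main (decided_End_mono rq tau_End).
  move/fexP => /(_ q (lexx q)) [a [r rq ra]]; exists r => //.
  exact/fEndP/(fscalar_decided_End ra).
- apply/fimpP => q qp /fexP /(_ q (lexx q)) [x [r rq x0]]; exists q => //.
  move=> a c; apply/fimpP => s sq ac; exists s => //.
  have [i xi] : exists i, e i x != 0.
    apply: contrapT => no; apply: x0; have [_ _] := be; apply=> i.
    by apply/eqP; apply: contrapT => /negP xi; apply: no; exists i.
  have := congr1 (e i) (ac (b i)); rewrite !linearZ /= eb eqxx.
  by rewrite [LHS]mulr1 [RHS]mulr1.
Qed.

End TreeModule.

Lemma is_basis_reindex (R : comNzRingType) (M : lmodType R) (I J : choiceType)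
    (b : I -> M) (h : J -> I) : bijective h -> is_basis b -> is_basis (b \o h).
Proof.
move=> [k hK kK] /is_basis_dual_system[e [eb efin e0]].
apply: (@dual_system_is_basis _ _ _ _ (e \o h)); split=> [i j|x|x ex] /=.
- by rewrite eb (can_eq hK).
- have [S xS] := efin x; exists (k @` S)%fset => j /xS hj.
  by apply/imfsetP; exists (h j).
- by apply: e0 => i; rewrite -[i]kK; exact: ex.
Qed.

Theorem theorem3p1 (R : comNzRingType) (Lambda : choiceType)
  (hR : below_kappa_omega R) (hLambda : below_kappa_omega Lambda)
  (F : lmodType R) (hF : free_of_rank Lambda F) :
  exists Fi : W -> submodClosed F,
    let FF := MkRomegaModule Fi in
    free_Romega FF /\ End_eq_R_in_any_generic_extension FF.
Proof.
have [b b_basis] := hF.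
have [Lfin|Linf] := pselect (finite_set [set: Lambda]).
  have /finite_setP[n /card_set_bijP[lev [levI lev_inj lev_surj]]] := Lfin.
  have inj t s : lev t = lev s -> t = s by apply: lev_inj; rewrite inE.
  have /choice[par parP] t : exists s, forall m, lev t = m.+1 -> lev s = m.
    case tm : (lev t) => [|m]; first by exists t.
    have [|s _ sm] := lev_surj m; last by exists s => _ [<-].
    by apply: ltnW; have := levI t I; rewrite tm.
  apply: (tree_module_End (par := par) (P := fun _ _ => True) b_basis parP).
    by move=> t s t0 s0; apply: inj; rewrite t0 s0.
  by move=> L Lsim t s /(sim_lev Lsim)/inj.
have [h [k hK kK]] := seq_bij Linf.
have k_bij : bijective k by exists h.
have [P P_rigid] := seq_tree_rigid (below_kappa_omega_not_erdos hLambda).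
apply: (tree_module_End (is_basis_reindex k_bij b_basis) _ _ P_rigid).
  by move=> t n /seq_parent_size[].
by move=> t s /size0nil -> /size0nil ->.
Qed.
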